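(* Let $K$ be a finite oriented simplicial complex and $q=p+1$. There is an integral input chain $\mathbf{c}\in\mathbb{Z}^m$ such that the OHCP LP over $K$ with input chain $\mathbf{c}$ has a nonintegral basic solution if and only if there is some $i\in\{1,\dots,m\}$ such that OHCP$_i$ has a nonintegral basic solution in which every nonzero $y$-coordinate is nonintegral.
   Context: Setting. $K$ is a finite simplicial complex of dimension $d$ with oriented simplices; $q=p+1$ with $1\le q\le d$; $K$ has $m$ $p$-simplices and $n$ $q$-simplices. $B=[\partial_q]$ is the $m\times n$ boundary matrix (rows indexed by $p$-simplices, columns by $q$-simplices; an entry is $0$ if the $p$-simplex is not a face of the $q$-simplex, $1$ if its orientation agrees with the one induced by the $q$-simplex, and $-1$ otherwise). Put $A=[\,I\ \ -I\ \ -B\ \ B\,]\in\mathbb{Z}^{m\times 2(m+n)}$. For an input chain $\mathbf{c}\in\mathbb{R}^m$ and nonnegative weights $\mathbf{w}\in\mathbb{R}^m$, the OHCP LP is: minimize $[\mathbf{w}^T\ \mathbf{w}^T\ \mathbf{0}^T\ \mathbf{0}^T]\,\mathbf{z}$ subject to $A\mathbf{z}=\mathbf{c}$, $\mathbf{z}\ge\mathbf{0}$, $\mathbf{z}\in\mathbb{R}^{2(m+n)}$. Let $P_A=\{\mathbf{z}:A\mathbf{z}=\mathbf{c}\}$. A basic solution is a point $\mathbf{z}\in P_A$ (not necessarily nonnegative) at which $2(m+n)$ linearly independent constraints among $A\mathbf{z}=\mathbf{c}$ and $\mathbf{z}\ge\mathbf{0}$ are active, i.e. hold with equality. OHCP$_i$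 is the OHCP LP with input chain the unit vector $\mathbf{e}_i$. The $y$-coordinates of $\mathbf{z}$ are the $z_j$ with $j>2m$. ''Integral'' means all coordinates are integers. *)

(* Defs.v *)
From HB Require Import structures.
From mathcomp Require Import all_boot all_order all_algebra all_fingroup.
From mathcomp Require Import reals.
Set Implicit Arguments.
Unset Strict Implicit.
Unset Printing Implicit Defensive.
Import Order.TTheory GRing.Theory Num.Theory.
Local Open Scope ring_scope.

(* The orientation of a simplex [s] is the class, up to even permutations, of
   the vertex ordering [oc_order s]; a vertex has a single orientation. *)
Record oriented_complex (V : finType) := OrientedComplex {
  oc_simplices :> {set {set V}};
  oc_nonempty : set0 \notin oc_simplices;
  oc_closed : forall s t : {set V},
    s \in oc_simplices -> t \subset s -> t != set0 -> t \in oc_simplices;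
  oc_order : {set V} -> seq V;
  oc_orderP : forall s : {set V},
    s \in oc_simplices -> uniq (oc_order s) /\ oc_order s =i s
}.

Definition complex_dim (V : finType) (K : oriented_complex V) : nat :=
  (\max_(s in oc_simplices K) #|s|).-1.

Definition simplices_of_dim (V : finType) (K : oriented_complex V) (p : nat) :
    {set {set V}} :=
  [set s in oc_simplices K | #|s| == p.+1].

Definition nb_simplices (V : finType) (K : oriented_complex V) (p : nat) : nat :=
  #|simplices_of_dim K p|.

Definition same_orientation (V : finType) (s t : seq V) : bool :=
  [exists g : {perm V},
    [&& perm_on [set x in s] g, ~~ odd_perm g & map g s == t]].

(* For [t] a codimension-1 face of [s] = [v_0, ..., v_q] opposite to [v_i], the
   orientation induced on [t] is (-1)^i [v_0, ..., v_(i-1), v_(i+1), ..., v_q];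
   when [t] is a vertex the sign (-1)^i is the only thing compared. *)
Definition agrees_with_induced (V : finType) (K : oriented_complex V)
    (t s : {set V}) : bool :=
  let i := find [pred x | x \notin t] (oc_order K s) in
  let face := [seq x <- oc_order K s | x \in t] in
  same_orientation face (oc_order K t) (+) odd i.

Definition incidence (V : finType) (K : oriented_complex V)
    (t s : {set V}) : int :=
  if t \subset s then (if agrees_with_induced K t s then 1 else -1) else 0.

(* Meant for [q = p.+1]. *)
Definition boundary_mx (V : finType) (K : oriented_complex V) (p q : nat) :
    'M[int]_(nb_simplices K p, nb_simplices K q) :=
  \matrix_(i, j) incidence K (enum_val i) (enum_val j).

(* Minimize [lp_cost *m z] subject to [lp_mx *m z = lp_rhs] and [z >= 0]. *)
Record standard_lp (R : realType) (k N : nat) := StandardLP {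
  lp_cost : 'rV[R]_N;
  lp_mx : 'M[R]_(k, N);
  lp_rhs : 'cV[R]_k
}.

(* The first [k] constraints are the rows of [lp_mx *m z = lp_rhs], the last
   [N] ones are [z j >= 0]. *)
Definition constraint_mx (R : realType) (k N : nat) (L : standard_lp R k N) :
    'M[R]_(k + N, N) := col_mx (lp_mx L) 1%:M.

Definition constraint_rhs (R : realType) (k N : nat) (L : standard_lp R k N) :
    'cV[R]_(k + N) := col_mx (lp_rhs L) 0.

Definition active (R : realType) (k N : nat) (L : standard_lp R k N)
    (z : 'cV[R]_N) (l : 'I_(k + N)) : Prop :=
  (constraint_mx L *m z) l 0 = constraint_rhs L l 0.

Definition basic_solution (R : realType) (k N : nat) (L : standard_lp R k N)
    (z : 'cV[R]_N) : Prop :=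
  lp_mx L *m z = lp_rhs L /\
  exists f : 'I_N -> 'I_(k + N),
    (forall j, active L z (f j)) /\ row_free (rowsub f (constraint_mx L)).

Definition integral (R : realType) (k : nat) (v : 'cV[R]_k) : Prop :=
  forall i, v i 0 \is a Num.int.

Definition ohcp_mx (m n : nat) (B : 'M[int]_(m, n)) :
    'M[int]_(m, (m + m) + (n + n)) :=
  row_mx (row_mx 1%:M (- 1%:M)) (row_mx (- B) B).

Definition ohcp_lp (R : realType) (V : finType) (K : oriented_complex V)
    (p q : nat) (w c : 'cV[R]_(nb_simplices K p)) :
    standard_lp R (nb_simplices K p)
      ((nb_simplices K p + nb_simplices K p)
       + (nb_simplices K q + nb_simplices K q)) :=
  StandardLP
    (row_mx (row_mx w^T w^T) (row_mx 0 0))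
    (map_mx intr (ohcp_mx (boundary_mx K p q)))
    c.

(* Main.v *)
(** If every minor of [B] lies in {0, 1, -1}, then so does every minor of the
    constraint matrix, which only adds to [B] signed copies of its columns and
    signed unit rows and columns, and Cramer's rule makes all basic solutions
    integral for integral input chains.
    Otherwise take a square submatrix [M] of [B] of least size with
    [|det M| > 1].  By Cramer's rule and minimality, the entries of [M^-1] have
    absolute value [< 1], so the nonzero ones are nonintegral; a column of
    [M^-1], completed by the slack variables outside the rows of [M], is a basic
    solution for the unit input chain of the corresponding row. *)
Require Import Defs.
From mathcomp Require Import all_boot all_order all_algebra.
From mathcomp Require Import boolp reals.
Set Implicit Arguments.
Unset Strict Implicit.
Unset Printing Implicit Defensive.
Import Order.TTheory GRing.Theory Num.Theory.
Local Open Scope ring_scope.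

(** * Total unimodularity and integrality of basic solutions *)

(* The selections [f] and [g] need not be injective: a repeated row or column
   only produces a zero determinant. *)
Definition totally_unimodular (m n : nat) (A : 'M[int]_(m, n)) : Prop :=
  forall k (f : 'I_k -> 'I_m) (g : 'I_k -> 'I_n), `|\det (mxsub f g A)| <= 1.

Lemma tu_trmx (m n : nat) (A : 'M[int]_(m, n)) :
  totally_unimodular A -> totally_unimodular A^T.
Proof. by move=> tuA k f g; rewrite -det_tr trmx_mxsub trmxK. Qed.

Lemma cofactor_mxsub (R : comNzRingType) (m n k : nat) (A : 'M[R]_(m, n))
    (f : 'I_k -> 'I_m) (g : 'I_k -> 'I_n) (i j : 'I_k) :
  cofactor (mxsub f g A) i j =
  (-1) ^+ (i + j) * \det (mxsub (f \o lift i) (g \o lift j) A).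
Proof. by congr (_ * \det _); apply/matrixP => a b; rewrite !mxE. Qed.

Lemma normr_cofactor_mxsub (m n k : nat) (A : 'M[int]_(m, n))
    (f : 'I_k -> 'I_m) (g : 'I_k -> 'I_n) (i j : 'I_k) :
  `|cofactor (mxsub f g A) i j| =
  `|\det (mxsub (f \o lift i) (g \o lift j) A)|.
Proof. by rewrite cofactor_mxsub normrM normrX normrN1 expr1n mul1r. Qed.

Lemma det_mxsub_noninj (R : comNzRingType) (m n k : nat) (A : 'M[R]_(m, n))
    (f : 'I_k -> 'I_m) (g : 'I_k -> 'I_n) :
  ~~ injectiveb f -> \det (mxsub f g A) = 0.
Proof.
case/injectivePn => a [b ne_ab eq_fab].
by apply: (determinant_alternate ne_ab) => j; rewrite !mxE eq_fab.
Qed.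

(** Induction on the size of the minor. Expanding along a selected signed unit column leaves at most
    one smaller minor; if no such column is selected, the minor is, up to sign, a minor of [A]. *)
Lemma tu_signed_cols (m n n' : nat) (A : 'M[int]_(m, n)) (A' : 'M[int]_(m, n')) :
  totally_unimodular A ->
  (forall j, (exists j0 (b : bool), col j A' = (-1) ^+ b *: col j0 A) \/
             (exists i (b : bool), col j A' = (-1) ^+ b *: delta_mx i 0)) ->
  totally_unimodular A'.
Proof.
move=> tuA colA' k; elim: k => [|k IHk] f g; first by rewrite det_mx00 normr1.
(* With [f] injective, a unit column has at most one nonzero entry in the selected rows. *)
have [f_inj | f_ninj] := boolP (injectiveb f); last first.
  by rewrite det_mxsub_noninj // normr0.
have [[j [i [b colj]]] | no_unit] := pselect (exists j i (b : bool),
    col (g j) A' = (-1) ^+ b *: delta_mx i 0).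
  have Dj l : mxsub f g A' l j = (-1) ^+ b * (f l == i)%:R.
    by have /matrixP/(_ (f l) 0) := colj; rewrite !mxE andbT.
  rewrite (expand_det_col _ j).
  have [/existsP[l0 /eqP fl0] | /existsPn nfi] := boolP [exists l, f l == i].
    rewrite (bigD1 l0) //= big1 ?addr0 => [|l ne_l].
      rewrite Dj fl0 eqxx mulr1 normrM normrX normrN1 expr1n mul1r.
      by rewrite normr_cofactor_mxsub IHk.
    rewrite Dj -fl0 (inj_eq (injectiveP _ f_inj)) (negPf ne_l).
    by rewrite mulr0 mul0r.
  by rewrite big1 ?normr0 // => l _; rewrite Dj (negPf (nfi l)) mulr0 mul0r.
have /fin_all_exists[g0 colg0] j :
    exists j0, exists b : bool, col (g j) A' = (-1) ^+ b *: col j0 A.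
  have [//|[i [b colj]]] := colA' (g j).
  by case: no_unit; exists j, i, b.
have [s colgs] := fin_all_exists colg0.
(* The column signs factor out as a diagonal matrix of determinant 1 or -1. *)
have -> : mxsub f g A' =
    mxsub f g0 A *m diag_mx (\row_j (-1) ^+ (s j : bool)).
  apply/matrixP => a j; rewrite mul_mx_diag !mxE mulrC.
  by have /matrixP/(_ (f a) 0) := colgs j; rewrite !mxE.
rewrite det_mulmx det_diag normrM normr_prod big1 ?mulr1 ?tuA // => j _.
by rewrite mxE normrX normrN1 expr1n.
Qed.

Lemma tu_col_mx1 (m n : nat) (A : 'M[int]_(m, n)) :
  totally_unimodular A -> totally_unimodular (col_mx A 1%:M).
Proof.
move=> /tu_trmx tuA; rewrite -[col_mx _ _]trmxK tr_col_mx trmx1.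
(* After transposition, the appended unit rows are unit columns. *)
apply/tu_trmx/(tu_signed_cols tuA) => j; case: (split_ordP j) => j' ->.
  by left; exists j', false; rewrite colKl scale1r.
by right; exists j', false; rewrite colKr col1 scale1r.
Qed.

Lemma tu_ohcp_mx (m n : nat) (B : 'M[int]_(m, n)) :
  totally_unimodular B -> totally_unimodular (ohcp_mx B).
Proof.
move=> tuB; apply: (tu_signed_cols tuB) => j.
case: (split_ordP j) => {}j ->; rewrite ?colKl ?colKr;
  case: (split_ordP j) => {}j ->; rewrite ?colKl ?colKr.
- by right; exists j, false; rewrite col1 scale1r.
- by right; exists j, true; rewrite linearN /= col1 scaleN1r.
- by left; exists j, true; rewrite linearN /= scaleN1r.
- by left; exists j, false; rewrite scale1r.
Qed.

(** The active constraints selected by [f] form a square integer system [M] with integral right-hand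
    side. Independence makes its determinant nonzero, hence 1 or -1, so solving by the adjugate
    creates no denominator. *)
Lemma tu_basic_solution_integral (R : realType) (k N : nat)
    (L : standard_lp R k N) (A : 'M[int]_(k, N)) (z : 'cV[R]_N) :
  lp_mx L = map_mx intr A -> totally_unimodular A -> integral (lp_rhs L) ->
  basic_solution L z -> integral z.
Proof.
move=> LA /tu_col_mx1 tuA int_rhs [_ [f [act_f free_f]]] i.
set M := rowsub f (col_mx A 1%:M).
have eqM : rowsub f (constraint_mx L) = map_mx intr M.
  by rewrite /constraint_mx LA map_mxsub map_col_mx map_mx1.
pose b := rowsub f (constraint_rhs L).
have int_b : integral b.
  move=> l; rewrite mxE /constraint_rhs; case: (split_ordP (f l)) => l' ->.
    by rewrite col_mxEu.
  by rewrite col_mxEd mxE.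
have Mz : map_mx intr M *m z = b.
  apply/colP => l.
  by rewrite -eqM mul_rowsub_mx [LHS]mxE [RHS]mxE act_f.
have detM0 : \det M != 0.
  have := free_f; rewrite eqM row_free_unit unitmxE unitfE det_map_mx.
  by rewrite intr_eq0.
have detz : (\det M)%:~R * z i 0 = (map_mx intr (\adj M) *m b) i 0.
  by rewrite -Mz mulmxA -map_mxM mul_adj_mx map_scalar_mx mul_scalar_mx mxE.
have : (\det M)%:~R * z i 0 \is a Num.int.
  rewrite detz mxE rpred_sum // => l _.
  by rewrite rpredM ?int_b // mxE rpred_int.
have : `|\det M| = 1.
  by apply/le_anti; rewrite tuA /= -gtz0_ge1 normr_gt0.
by case: (ger0P (\det M)) => _ dM;
  [|have {}dM : \det M = -1 by rewrite -dM opprK];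
  rewrite dM ?mul1r // rmorphN1 mulN1r rpredN.
Qed.

(** The empty minor is 1, so the least bad size is a successor [k.+1]. The bound at size [k] is the
    one that controls the cofactors. *)
Lemma minimal_bad_minor (m n : nat) (B : 'M[int]_(m, n)) :
  ~ totally_unimodular B ->
  exists k (f : 'I_k.+1 -> 'I_m) (g : 'I_k.+1 -> 'I_n),
    1 < `|\det (mxsub f g B)| /\
    forall (f' : 'I_k -> 'I_m) (g' : 'I_k -> 'I_n),
      `|\det (mxsub f' g' B)| <= 1.
Proof.
move=> ntuB.
pose bad k := `[< exists (f : 'I_k -> 'I_m) (g : 'I_k -> 'I_n),
  1 < `|\det (mxsub f g B)| >].
have exbad : exists k, bad k.
  apply: contrapT => nbad; apply: ntuB => k f g; rewrite leNgt; apply/negP.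
  by move=> gt1; apply: nbad; exists k; apply/asboolP; exists f, g.
case: (ex_minnP exbad) => [[|k]] /asboolP[f [g gt1]] min_k.
  by rewrite det_mx00 normr1 ltxx in gt1.
exists k, f, g; split=> // f' g'; rewrite leNgt; apply/negP => gt1'.
suff /min_k : bad k by rewrite ltnn.
by apply/asboolP; exists f', g'.
Qed.

(** * Basic solutions built from a nonsingular submatrix of [B] *)

Lemma map_ohcp_mx_col (R : realType) (m n : nat) (B : 'M[int]_(m, n))
    (xp xm : 'cV[R]_m) (yp ym : 'cV[R]_n) :
  map_mx intr (ohcp_mx B) *m col_mx (col_mx xp xm) (col_mx ym yp) =
  xp - xm + map_mx intr B *m (yp - ym).
Proof.
rewrite /ohcp_mx !map_row_mx !mul_row_col !map_mxN map_mx1 !mulNmx !mul1mx.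
by rewrite mulmxBr [- _ + _]addrC.
Qed.

Lemma mulmx_cols_support (R : comNzRingType) (m n k : nat) (A : 'M[R]_(m, n))
    (g : 'I_k -> 'I_n) (y : 'cV[R]_n) :
  injective g -> (forall j, j \notin codom g -> y j 0 = 0) ->
  A *m y = colsub g A *m rowsub g y.
Proof.
move=> g_inj y0; apply/matrixP => i b; rewrite ord1 !mxE.
rewrite (bigID [in codom g]) /= [X in _ + X]big1 ?addr0; last first.
  by move=> j /y0 ->; rewrite mulr0.
rewrite -big_uniq; last by rewrite /codom /image_mem map_inj_uniq ?enum_uniq.
by rewrite big_image; apply: eq_bigr => l _; rewrite !mxE.
Qed.

(* The last hypothesis says that the columns indexed by the support of [z] are
   linearly independent. *)
Lemma basic_solution_of_support (R : realType) (k N : nat)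
    (L : standard_lp R k N) (z : 'cV[R]_N) :
  lp_mx L *m z = lp_rhs L ->
  (forall v : 'cV[R]_N, lp_mx L *m v = 0 ->
     (forall j, z j 0 = 0 -> v j 0 = 0) -> v = 0) ->
  basic_solution L z.
Proof.
move=> Lz ker0; split=> //.
pose S := [set l | (constraint_mx L *m z) l 0 == constraint_rhs L l 0].
pose D := rowsub (fun i : 'I_#|S| => enum_val i) (constraint_mx L).
(* A vector orthogonal to all active rows is in the kernel of [lp_mx L] and vanishes where [z] does,
   so [ker0] kills it. Hence the active rows span, and [N] independent ones can be extracted. *)
have fullD : row_full D.
  rewrite /row_full -mxrank_tr -/(row_free D^T) -kermx_eq0.
  apply/rowV0P => u /sub_kermxP uD.
  have CS l : l \in S -> (constraint_mx L *m u^T) l 0 = 0.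
    move=> Sl; have /matrixP/(_ (enum_rank_in Sl l) 0) :
      D *m u^T = 0 by rewrite -[D]trmxK -trmx_mul uD trmx0.
    by rewrite mul_rowsub_mx !mxE enum_rankK_in.
  apply: trmx_inj; rewrite trmx0; apply: ker0 => [|j zj0].
    apply/colP => i; have := CS (lshift N i).
    rewrite inE /constraint_mx /constraint_rhs !mul_col_mx !col_mxEu Lz eqxx.
    by move=> ->; rewrite ?mxE.
  have := CS (rshift k j).
  rewrite inE /constraint_mx /constraint_rhs !mul_col_mx !col_mxEd !mul1mx zj0.
  by rewrite mxE eqxx => ->.
exists (fun j => enum_val (fullrankfun fullD j)); split=> [j|].
  by have := enum_valP (fullrankfun fullD j); rewrite inE => /eqP.
have := fullrowsub_free fullD.
by congr (is_true (row_free _)); apply/matrixP => a b; rewrite !mxE.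
Qed.

(** The support uses only unit columns outside the rows [f] and the columns [g] of [B]. In a
    dependency among these, the rows [f] involve only the invertible submatrix, so the coefficients
    on [B] vanish, and then those on the unit columns. *)
Lemma ohcp_basic_solution (R : realType) (m n k : nat) (B : 'M[int]_(m, n))
    (f : 'I_k -> 'I_m) (g : 'I_k -> 'I_n)
    (L : standard_lp R m ((m + m) + (n + n)))
    (xp : 'cV[R]_m) (yp : 'cV[R]_n) :
  lp_mx L = map_mx intr (ohcp_mx B) -> \det (mxsub f g B) != 0 ->
  xp + map_mx intr B *m yp = lp_rhs L ->
  (forall l, xp (f l) 0 = 0) -> (forall j, j \notin codom g -> yp j 0 = 0) ->
  basic_solution L (col_mx (col_mx xp 0) (col_mx 0 yp)).
Proof.
move=> LB det0 rhsE xf yg; apply: basic_solution_of_support.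
  by rewrite LB map_ohcp_mx_col !subr0.
have g_inj : injective g.
  apply/injectiveP; apply: contraNT det0 => ng.
  by rewrite -det_tr trmx_mxsub det_mxsub_noninj.
move=> v; rewrite -[v]vsubmxK -[usubmx v]vsubmxK -[dsubmx v]vsubmxK.
move: (usubmx (usubmx v)) (dsubmx (usubmx v)) => v1 v2.
move: (usubmx (dsubmx v)) (dsubmx (dsubmx v)) => v3 v4 {v}.
rewrite LB map_ohcp_mx_col => Av0 supp.
have v2_0 : v2 = 0.
  apply/colP => i; have := supp (lshift _ (rshift _ i)).
  by rewrite !(col_mxEu, col_mxEd) mxE; apply.
have v3_0 : v3 = 0.
  apply/colP => i; have := supp (rshift _ (lshift _ i)).
  by rewrite !(col_mxEu, col_mxEd) mxE; apply.
have v1f l : v1 (f l) 0 = 0.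
  by have := supp (lshift _ (lshift _ (f l))); rewrite !col_mxEu; apply.
have v4g j : j \notin codom g -> v4 j 0 = 0.
  by move=> /yg; have := supp (rshift _ (rshift _ j)); rewrite !col_mxEd.
move: Av0; rewrite v2_0 v3_0 !subr0 => v1B.
have unitM : map_mx (intr : int -> R) (mxsub f g B) \in unitmx.
  by rewrite unitmxE unitfE det_map_mx intr_eq0.
have v4g0 : rowsub g v4 = 0.
  rewrite -[LHS](mulKmx unitM); apply/eqP.
  suff -> : map_mx intr (mxsub f g B) *m rowsub g v4 = 0 by rewrite mulmx0.
  apply/colP => l; have /colP/(_ (f l)) := v1B.
  rewrite (mulmx_cols_support _ g_inj v4g) mxE v1f add0r.
  by rewrite !mxE => eq0; rewrite -[RHS]eq0; apply: eq_bigr => a _; rewrite !mxE.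
have v4_0 : v4 = 0.
  by rewrite -[v4]mul1mx (mulmx_cols_support _ g_inj v4g) v4g0 mulmx0.
by move: v1B; rewrite v4_0 mulmx0 addr0 => ->; rewrite !col_mx0.
Qed.

Lemma ohcp_nonintegral_basic_solution (R : realType) (m n : nat)
    (B : 'M[int]_(m, n)) :
  ~ totally_unimodular B ->
  exists i : 'I_m, forall L : standard_lp R m ((m + m) + (n + n)),
    lp_mx L = map_mx intr (ohcp_mx B) -> lp_rhs L = delta_mx i 0 ->
    exists z, [/\ basic_solution L z, ~ integral z &
      forall j : 'I_((m + m) + (n + n)), (m + m <= j)%N ->
        z j 0 != 0 -> z j 0 \isn't a Num.int].
Proof.
case/minimal_bad_minor => k [f [g [gt1 le1]]].
exists (f ord0) => L LB rhsE.
set M := mxsub f g B in gt1.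
have detM0 : \det M != 0 by rewrite -normr_gt0 (lt_trans ltr01).
have f_inj : injective f.
  by apply/injectiveP; apply: contraNT detM0 => /det_mxsub_noninj->.
have g_inj : injective g.
  apply/injectiveP; apply: contraNT detM0 => ng.
  by rewrite -det_tr trmx_mxsub det_mxsub_noninj.
(* This is the first column of the inverse of [M]; any other would do, with the matching row of [M]
   as input. *)
pose y : 'cV[R]_k.+1 := (\det M)%:~R^-1 *: map_mx intr (col ord0 (\adj M)).
have My : map_mx intr M *m y = delta_mx ord0 0.
  rewrite -scalemxAr -map_mxM colE mulmxA mul_mx_adj mul_scalar_mx map_mxZ.
  by rewrite map_delta_mx scalerA mulVf ?intr_eq0 // scale1r.
(* The numerator is a [k]-minor up to sign, at most 1 in absolute value, while the denominator
   exceeds 1. *)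
have y_lt1 l : `|y l 0| < 1.
  rewrite !mxE normrM normfV -!intr_norm mulrC.
  rewrite ltr_pdivrMr ?ltr0z ?normr_gt0 // mul1r ltr_int.
  by rewrite normr_cofactor_mxsub (le_lt_trans (le1 _ _)).
have y_nint l : y l 0 != 0 -> y l 0 \isn't a Num.int.
  move=> yl0; apply: contraL (y_lt1 l) => int_yl.
  by rewrite -leNgt norm_intr_ge1.
(* Extension of [y] by zero outside the columns [g]. *)
pose yp := colsub g 1%:M *m y.
have ypg l : yp (g l) 0 = y l 0.
  rewrite mxE (bigD1 l) //= big1 ?addr0 => [|l' ne_l].
    by rewrite !mxE eqxx mul1r.
  by rewrite !mxE (inj_eq g_inj) eq_sym (negPf ne_l) mul0r.
have yp0 j : j \notin codom g -> yp j 0 = 0.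
  move=> ngj; rewrite mxE big1 // => l _; rewrite !mxE.
  have [jl|_] := eqVneq j (g l); last by rewrite mul0r.
  by rewrite jl codom_f in ngj.
(* The slack forced by the equality constraints; it may be negative, which a basic solution allows.
   It vanishes on the rows [f] by [My]. *)
pose xp : 'cV[R]_m := delta_mx (f ord0) 0 - map_mx intr B *m yp.
have xpf l : xp (f l) 0 = 0.
  have -> : xp (f l) 0 =
      (delta_mx (f ord0) 0 : 'cV[R]_m) (f l) 0 - (map_mx intr M *m y) l 0.
    rewrite [LHS]mxE [X in _ + X]mxE /yp mulmxA mulmx_colsub mulmx1.
    congr (_ - _).
    by rewrite !mxE; apply: eq_bigr => a _; rewrite !mxE.
  by rewrite My !mxE (inj_eq f_inj) subrr.
exists (col_mx (col_mx xp 0) (col_mx 0 yp)); split.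
- by apply: (ohcp_basic_solution LB detM0) => //; rewrite subrK.
(* Since [M] sends [y] to a unit vector, [y] has a nonzero, hence nonintegral, entry. *)
- have [l yl0] : exists l, y l 0 != 0.
    apply/existsP; apply: contraT => /existsPn y0.
    have /colP/(_ ord0) := My; rewrite (_ : y = 0).
      by rewrite mulmx0 !mxE eqxx => /eqP; rewrite eq_sym oner_eq0.
    by apply/colP => l; rewrite [RHS]mxE; apply/eqP; rewrite -[_ == _]negbK y0.
  move=> /(_ (rshift _ (rshift _ (g l)))); rewrite !col_mxEd ypg.
  by apply/negP/y_nint.
- move=> j; case: (split_ordP j) => {}j -> /=.
    by rewrite leqNgt ltn_ord.
  move=> _; rewrite col_mxEd; case: (split_ordP j) => {}j ->.
    by rewrite col_mxEu mxE eqxx.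
  rewrite col_mxEd; have [/codomP[l ->]|/yp0->] := boolP (j \in codom g).
    by rewrite ypg; apply: y_nint.
  by rewrite eqxx.
Qed.

Theorem lemma4p5 (R : realType) (V : finType) (K : oriented_complex V)
    (d p q : nat) (hd : complex_dim K = d) (hq : q = p.+1)
    (hqd : (1 <= q <= d)%N)
    (w : 'cV[R]_(nb_simplices K p)) (hw : forall i, 0 <= w i 0) :
  (exists c : 'cV[R]_(nb_simplices K p),
     integral c /\
     exists z, basic_solution (ohcp_lp q w c) z /\ ~ integral z)
  <->
  (exists i : 'I_(nb_simplices K p),
     exists z, [/\ basic_solution (ohcp_lp q w (delta_mx i 0)) z,
       ~ integral z &
       forall j : 'I_(_), (nb_simplices K p + nb_simplices K p <= j)%N ->
         z j 0 != 0 -> z j 0 \isn't a Num.int]).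
Proof.
split=> [[c [int_c [z [basic_z nint_z]]]] | [i [z [basic_z nint_z _]]]].
  have ntuB : ~ totally_unimodular (boundary_mx K p q).
    move=> /tu_ohcp_mx tuA; apply: nint_z.
    exact: (tu_basic_solution_integral _ tuA _ basic_z).
  have [i ex_z] := ohcp_nonintegral_basic_solution R ntuB.
  by exists i; apply: ex_z.
(* A unit chain is itself an integral input chain. *)
exists (delta_mx i 0); split; last by exists z.
by move=> l; rewrite mxE natr_int.
Qed.
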